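(* Let $s$ and $q$ be positive integers with $s \equiv 3 \pmod 4$, $q \equiv 3 \pmod 8$ and $2s = q - 5$. If there exists a skew Hadamard matrix of order $s+1$ and there exists a conference matrix of order $q$, then there exists a Hadamard matrix of order $2q(s+1)$.
   Context: A Hadamard matrix of order $n$ is an $n\times n$ matrix $H$ with entries in $\{-1,1\}$ such that $HH^T = H^TH = nI_n$. A skew Hadamard matrix is a Hadamard matrix $H$ of the form $H = S + I$ with $S$ skew-symmetric ($S^T=-S$). Write $J_q$ for the $q\times q$ all-ones matrix. In this paper a conference matrix of order $q$ means a $q\times q$ matrix $C_q$ with zero diagonal, entries $\pm 1$ off the diagonal, satisfying $C_qC_q^T = qI_q - J_q$ and $C_qJ_q = J_qC_q = 0$ (for example, for a prime power $q$, the matrix $C_q=[\chi(\alpha_j-\alpha_i)]_{i,j}$ where $\chi$ is the quadratic character of $GF(q)=\{\alpha_1,\dots,\alpha_q\}$ with $\chi(0)=0$). *)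

(* Defs.v *)
From mathcomp Require Import all_boot all_order all_algebra.

Set Implicit Arguments.
Unset Strict Implicit.
Unset Printing Implicit Defensive.

Import GRing.Theory.
Local Open Scope ring_scope.

Definition is_hadamard (n : nat) (H : 'M[int]_n) : Prop :=
  [/\ forall i j, H i j = 1 \/ H i j = -1,
      H *m H^T = n%:R%:M
    & H^T *m H = n%:R%:M].

Definition is_skew_hadamard (n : nat) (H : 'M[int]_n) : Prop :=
  is_hadamard H /\ exists2 S : 'M[int]_n, S^T = - S & H = S + 1%:M.

(* This is the core of a conference matrix in the usual sense (a matrix of
   order n with C *m C^T = (n - 1)%:M); no symmetry condition is imposed. *)
Definition is_conference (q : nat) (C : 'M[int]_q) : Prop :=
  [/\ forall i, C i i = 0,
      forall i j, i != j -> C i j = 1 \/ C i j = -1,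
      C *m C^T = q%:R%:M - const_mx 1,
      C *m const_mx 1 = 0 :> 'M_q
    & const_mx 1 *m C = 0 :> 'M_q].

(* Main.v *)
Require Import Defs.
From mathcomp Require Import all_boot all_order all_algebra.
From mathcomp Require Import zify ring mxtens.

(** Let [Z] be the skew part of the skew Hadamard matrix of order [m = s + 1],
    and put [n := 2m = q - 3].  The block matrices
    [K := [Z, 1 + Z; 1 - Z, Z]] and [L := [Z, 1 - Z; -(1 + Z), -Z]] are weighing
    matrices of order [n] and weight [n - 1] with zero diagonal; [L] is skew and
    [K (L^T - 2)] is symmetric.  A parity argument modulo 4 shows that the
    conference matrix [C] is skew, and then
    [1 *t (J - 2) + K *t C + L *t 1] is a Hadamard matrix of order [nq]: in its
    Gram matrix the contributions of [J] cancel because [q - 4 = n - 1], and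
    those of [C] cancel because [K (L^T - 2)] is symmetric. *)

Set Implicit Arguments.
Unset Strict Implicit.
Unset Printing Implicit Defensive.

Import Order.TTheory GRing.Theory Num.Theory.
Local Open Scope ring_scope.

Definition offdiag_sign (n : nat) (A : 'M[int]_n) : Prop :=
  (forall i, A i i = 0) /\ (forall i j, i != j -> A i j = 1 \/ A i j = -1).

(** Over a domain [A] need not be invertible, so the adjugate serves instead: [A *m (B *m A - a%:M)]
    vanishes, and multiplying by [\adj A] leaves the factor [\det A], nonzero because
    [\det A * \det B] is a power of [a]. *)
Lemma mulmx_scalarC (R : idomainType) (n : nat) (A B : 'M[R]_n) (a : R) :
  a != 0 -> A *m B = a%:M -> B *m A = a%:M.
Proof.
move=> a0 AB.
have detA0 : \det A != 0.
  apply: contraNneq a0 => detA0.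
  have /eqP := congr1 determinant AB.
  by rewrite det_mulmx detA0 mul0r det_scalar eq_sym expf_eq0 => /andP[].
have : \adj A *m A *m (B *m A - a%:M) = 0.
  by rewrite -mulmxA mulmxBr mulmxA AB scalar_mxC subrr mulmx0.
rewrite mul_adj_mx mul_scalar_mx => /eqP.
by rewrite scalemx_eq0 (negPf detA0) subr_eq0 => /eqP.
Qed.

Lemma is_hadamard_gram (n : nat) (H : 'M[int]_n) :
  (0 < n)%N -> (forall i j, H i j = 1 \/ H i j = -1) ->
  H *m H^T = n%:R%:M -> is_hadamard H.
Proof.
move=> n0 Hpm HHT; split=> //.
by apply: mulmx_scalarC HHT; rewrite pnatr_eq0 -lt0n.
Qed.

(* The sum over [k != i, j] of [(C i k - 1) * (C j k - 1)] is a multiple of 4,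
   and equals [q - 3 + C i j + C j i]. *)
Lemma conference_skew (q : nat) (C : 'M[int]_q) :
  q = 3 %[mod 4] -> is_conference C -> C^T = - C.
Proof.
move=> q4 [C0 C1 CCT CJ _]; apply/matrixP => i j; rewrite !mxE.
have [->|ij] := eqVneq i j; first by rewrite C0.
have sum0 k : \sum_l C k l = 0.
  transitivity ((C *m (const_mx 1 : 'M_q)) k i).
    by rewrite mxE; apply: eq_bigr => l _; rewrite mxE mulr1.
  by rewrite CJ mxE.
have dot : \sum_l C i l * C j l = -1.
  transitivity ((C *m C^T) i j).
    by rewrite mxE; apply: eq_bigr => l _; rewrite mxE.
  by rewrite CCT !mxE (negPf ij) mulr0n add0r.
have ji : j != i by rewrite eq_sym.
have tot : \sum_l (C i l - 1) * (C j l - 1) = q%:R - 1 :> int.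
  rewrite (eq_bigr (fun l => C i l * C j l - C i l - C j l + 1)); last first.
    by move=> l _; ring.
  rewrite !big_split /= !sumrN !sum0 dot sumr_const card_ord; ring.
have dvd4 : (4 %| \sum_(l | (l != i) && (l != j)) (C i l - 1) * (C j l - 1))%Z.
  apply: rpred_sum => l /andP[li lj].
  have il : i != l by rewrite eq_sym.
  have jl : j != l by rewrite eq_sym.
  by have [->|->] := C1 i l il; have [->|->] := C1 j l jl.
rewrite (bigD1 i) //= (bigD1 j) //= !C0 in tot.
case/dvdzP: dvd4 => t Et; rewrite {}Et natz in tot.
(* Equal signs would make [q - 3 + 2] or [q - 3 - 2] a multiple of 4. *)
have [Eij|Eij] := C1 i j ij; have [Eji|Eji] := C1 j i ji;
  rewrite Eij Eji in tot *; lia.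
Qed.

Definition tensor_array (n q : nat) (K L : 'M[int]_n) (C : 'M[int]_q) :=
  1%:M *t (const_mx 1 - 2%:M) + K *t C + L *t 1%:M.

(** The three summands have disjoint supports covering every position: a diagonal block is [J - 2],
    and an off-diagonal block is [K i j] times [C], whose zero diagonal is filled by [L i j]. *)
Lemma tensor_array_sign (n q : nat) (K L : 'M[int]_n) (C : 'M[int]_q) :
  offdiag_sign K -> offdiag_sign L -> offdiag_sign C ->
  forall i j, tensor_array K L C i j = 1 \/ tensor_array K L C i j = -1.
Proof.
move=> [K0 K1] [L0 L1] [C0 C1] x y; rewrite /tensor_array.
have [i k] := mxtens_indexP x; have [j l] := mxtens_indexP y.
rewrite [_ (mxtens_index _) _]mxE [X in X + _]mxE !tensmxE.
have [<-|ij] := eqVneq i j; have [<-|kl] := eqVneq k l;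
  rewrite ?K0 ?L0 ?C0 !mxE ?eqxx ?(negPf ij) ?(negPf kl).
- by right.
- by rewrite !mul0r; left.
- by rewrite mul0r mulr0 !add0r mulr1; exact: L1.
- rewrite mul0r mulr0 add0r addr0.
  by have [->|->] := K1 i j ij; have [->|->] := C1 k l kl;
    [left|right|right|left].
Qed.

(** The squares of the three summands leave the scalar [4 + (n - 1) * (q + 1) = n * q]; the products
    of the first with the third cancel because [L] is skew. *)
Lemma tensor_array_gram (n q : nat) (K L : 'M[int]_n) (C : 'M[int]_q) :
  q = (n + 3)%N ->
  K *m K^T = (n%:R - 1)%:M -> L *m L^T = (n%:R - 1)%:M -> L^T = - L ->
  K *m L^T - L *m K^T = 2 *: (K - K^T) ->
  C^T = - C -> is_conference C ->
  tensor_array K L C *m (tensor_array K L C)^T = (n * q)%:R%:M.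
Proof.
move=> qn KK LL LT KL CT [C0 _ CC CJ JC].
have JJ : (const_mx 1 : 'M_q) *m const_mx 1 = const_mx q%:R :> 'M[int]_q.
  apply/matrixP => i j; rewrite !mxE (eq_bigr (fun=> 1)) ?sumr_const ?card_ord //.
  by move=> l _; rewrite !mxE mulr1.
rewrite /tensor_array; set J2 := const_mx 1 - 2%:M.
have J2T : J2^T = J2 by rewrite /J2 linearB /= trmx_const tr_scalar_mx.
have J2J2 : J2 *m J2 = const_mx (q%:R - 4) + 4%:M.
  rewrite /J2 mulmxBl !mulmxBr JJ !mul_scalar_mx !mul_mx_scalar.
  by apply/matrixP => i j; rewrite !mxE; case: eqP => _ /=; ring.
have CJ2 : C *m J2 = - 2 *: C.
  by rewrite mulmxBr CJ mul_mx_scalar sub0r scaleNr.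
have J2C : J2 *m - C = 2 *: C.
  by rewrite mulmxN mulmxBl JC mul_scalar_mx sub0r opprK.
clearbody J2; rewrite linearD /= [(_ + _)^T]linearD /=.
rewrite !trmx_tens !trmx1 J2T.
rewrite !mulmxDl !mulmxDr !tensmx_mul !mul1mx !mulmx1 KK LL CC LT CT.
(* Trading [K *m L^T] for [L *m K^T] leaves a single unknown product, abstracted below as [X], whose
   total coefficient is zero. *)
have {}KL : K *m - L = L *m K^T + 2 *: (K - K^T).
  by rewrite -KL LT addrC subrK.
rewrite J2J2 CJ2 J2C KL.
apply/matrixP => x y.
have [i k] := mxtens_indexP x; have [j l] := mxtens_indexP y.
have addE (A B : 'M[int]_(n * q)) u v : (A + B) u v = A u v + B u v.
  by rewrite mxE.
rewrite !addE !tensmxE [RHS]mxE (can_eq (@mxtens_indexK _ _)) xpair_eqE.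
move: (L *m K^T) => X; rewrite !mxE.
have qnR : q%:R = n%:R + 3 :> int by rewrite qn natrD.
rewrite natrM qnR.
by case: (i == j); case: (k == l) => /=; ring.
Qed.

(** For [H = Z + 1] with [Z] skew, [H *m H^T] is [(1 + Z) *m (1 - Z) = 1 - Z *m Z]. *)
Lemma skew_hadamard_skew_part (m : nat) (H : 'M[int]_m) :
  is_skew_hadamard H ->
  exists Z : 'M[int]_m,
    [/\ offdiag_sign Z, Z^T = - Z & Z *m Z = (1 - m%:R)%:M].
Proof.
case=> [[Hpm HHT _] [Z ZT HZ]]; exists Z; split=> //.
- split=> [i|i j ij].
    have := congr1 (fun A : 'M_m => A i i) ZT.
    by rewrite /= !mxE => /esym/eqP; rewrite eqNr => /eqP.
  by have := Hpm i j; rewrite HZ !mxE (negPf ij) addr0.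
- move: HHT; rewrite HZ linearD /= ZT trmx1 mulmxDl mul1mx mulmxDr mulmx1 mulmxN.
  rewrite addrA addrK => E.
  by rewrite raddfB /= -E opprD opprK addrC subrK.
Qed.

Lemma offdiag_sign_block (m p : nat) (A : 'M[int]_m) (B : 'M[int]_(m, p))
    (D : 'M[int]_(p, m)) (E : 'M[int]_p) :
  offdiag_sign A -> offdiag_sign E ->
  (forall i j, B i j = 1 \/ B i j = -1) ->
  (forall i j, D i j = 1 \/ D i j = -1) ->
  offdiag_sign (block_mx A B D E).
Proof.
move=> [A0 A1] [E0 E1] Bpm Dpm; split=> [i|i j].
  by case: (split_ordP i) => k ->; rewrite ?block_mxEul ?block_mxEdr.
case: (split_ordP i) => k ->; case: (split_ordP j) => l ->;
  rewrite ?block_mxEul ?block_mxEur ?block_mxEdl ?block_mxEdr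
          ?eq_lshift ?eq_rshift //.
- exact: A1.
- exact: E1.
Qed.

Lemma offdiag_signN (m : nat) (A : 'M[int]_m) : offdiag_sign A -> offdiag_sign (- A).
Proof.
case=> A0 A1; split=> [i|i j ij]; rewrite mxE ?A0 //.
by have [->|->] := A1 i j ij; [right|left].
Qed.

Lemma offdiag_sign_add1 (m : nat) (A : 'M[int]_m) (i j : 'I_m) :
  offdiag_sign A -> (1%:M + A) i j = 1 \/ (1%:M + A) i j = -1.
Proof.
case=> A0 A1; rewrite !mxE; have [<-|ij] := eqVneq i j.
  by rewrite A0; left.
by rewrite add0r; exact: A1.
Qed.

Section Doubling.
Variables (m : nat) (Z : 'M[int]_m).
Hypothesis Zsign : offdiag_sign Z.
Hypothesis ZT : Z^T = - Z.
Hypothesis ZZ : Z *m Z = (1 - m%:R)%:M.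

(** In Kronecker form this is [[1, 1; -1, 1]] times [Z] plus [[0, 1; 1, 0]] times the identity; the
    two parts give the weight [2 * (m - 1) + 1]. *)
Definition doubleK : 'M[int]_(m + m) :=
  block_mx Z (1%:M + Z) (1%:M - Z) Z.

Definition doubleL : 'M[int]_(m + m) :=
  block_mx Z (1%:M - Z) (- (1%:M + Z)) (- Z).

Lemma doubleK_sign : offdiag_sign doubleK.
Proof.
apply: offdiag_sign_block => // i j; apply: offdiag_sign_add1 => //.
exact: offdiag_signN.
Qed.

Lemma doubleL_sign : offdiag_sign doubleL.
Proof.
have ZN := offdiag_signN Zsign.
apply: offdiag_sign_block => // i j; first exact: offdiag_sign_add1.
by rewrite mxE; have [->|->] := offdiag_sign_add1 i j Zsign; [right|left].
Qed.

Let trD : (1%:M + Z)^T = 1%:M - Z.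
Proof. by rewrite linearD /= trmx1 ZT. Qed.

Let trB : (1%:M - Z)^T = 1%:M + Z.
Proof. by rewrite linearB /= trmx1 ZT opprK. Qed.

Lemma doubleL_skew : doubleL^T = - doubleL.
Proof.
rewrite tr_block_mx opp_block_mx; congr block_mx.
- exact: ZT.
- by rewrite linearN /= trD.
- by rewrite trB opprK.
- by rewrite linearN /= ZT.
Qed.

Lemma doubleK_gram : doubleK *m doubleK^T = ((m + m)%:R - 1)%:M.
Proof.
rewrite tr_block_mx mulmx_block trD trB ZT.
rewrite !(mulmxDl, mulmxDr, mulmxN, mulNmx, mulmx1, mul1mx) ZZ.
rewrite [RHS]scalar_mx_block natrD; congr block_mx; apply/matrixP => i j;
  by rewrite !mxE; case: (i == j) => /=; ring.
Qed.

Lemma doubleL_gram : doubleL *m doubleL^T = ((m + m)%:R - 1)%:M.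
Proof.
rewrite doubleL_skew opp_block_mx mulmx_block.
rewrite !(mulmxDl, mulmxDr, mulmxN, mulNmx, mulmx1, mul1mx, opprD, opprK) ZZ.
rewrite [RHS]scalar_mx_block natrD; congr block_mx; apply/matrixP => i j;
  by rewrite !mxE; case: (i == j) => /=; ring.
Qed.

(** This expresses the symmetry of [K (L^T - 2)]; both sides equal
    [block_mx (4 *: Z) 0 0 (4 *: Z)]. *)
Lemma doubleKL :
  doubleK *m doubleL^T - doubleL *m doubleK^T = 2 *: (doubleK - doubleK^T).
Proof.
rewrite doubleL_skew mulmxN tr_block_mx trD trB ZT.
rewrite opp_block_mx !mulmx_block !opp_block_mx !add_block_mx scale_block_mx.
rewrite !(mulmxDl, mulmxDr, mulmxN, mulNmx, mulmx1, mul1mx, opprD, opprK) ZZ.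
congr block_mx; apply/matrixP => i j;
  by rewrite !mxE; case: (i == j) => /=; ring.
Qed.
End Doubling.

Theorem theorem3p3 (s q : nat) (s_gt0 : (0 < s)%N) (q_gt0 : (0 < q)%N)
    (s_mod4 : s = 3 %[mod 4]) (q_mod8 : q = 3 %[mod 8])
    (s_q : (2 * s)%N = (q - 5)%N)
    (skewH : exists H : 'M[int]_(s + 1), is_skew_hadamard H)
    (confC : exists C : 'M[int]_q, is_conference C) :
  exists H : 'M[int]_(2 * q * (s + 1)), is_hadamard H.
Proof.
have [H /skew_hadamard_skew_part[Z [Zsign ZT ZZ]]] := skewH.
have [C confC'] := confC; have [C0 C1 _ _ _] := confC'.
(* The subtraction in [s_q] is truncated; [s_gt0] forces [q > 5], so it is exact. *)
have qn : q = (s + 1 + (s + 1) + 3)%N by lia.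
have CT : C^T = - C by apply: conference_skew confC'; lia.
have -> : (2 * q * (s + 1) = (s + 1 + (s + 1)) * q)%N by lia.
exists (tensor_array (doubleK Z) (doubleL Z) C).
apply: is_hadamard_gram; first by lia.
  by apply: tensor_array_sign; [exact: doubleK_sign|exact: doubleL_sign|].
apply: tensor_array_gram => //.
- exact: doubleK_gram.
- exact: doubleL_gram.
- exact: doubleL_skew.
- exact: doubleKL.
Qed.
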